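(* Let $\mathcal D$ be a dictionary in a real Hilbert space $\mathbb H$. If $f\in A_1(\mathcal D)$, then any sequence $(f_m)_{m\ge 0}$ generated by the Convex-Relaxed Greedy Algorithm applied to $f$ satisfies $$\|f-f_m\|\le \frac{2}{\sqrt{m+4}},\qquad m=0,1,2,\ldots$$
   Context: Let $\mathbb H$ be a real Hilbert space with inner product $\langle\cdot,\cdot\rangle$ and induced norm $\|\cdot\|$. A dictionary $\mathcal D\subset\mathbb H$ is a set such that $\|g\|=1$ for every $g\in\mathcal D$, $-g\in\mathcal D$ whenever $g\in\mathcal D$ (symmetry), and the linear span of $\mathcal D$ is dense in $\mathbb H$. The class $A_1(\mathcal D)$ is the closure in $\mathbb H$ of the set of all $f=\sum_{k\in\Lambda}a_kg_k$ with $\Lambda$ a finite index set, $g_k\in\mathcal D$, $a_k$ scalars, and $\sum_{k\in\Lambda}|a_k|\le 1$. Convex-Relaxed Greedy Algorithm (CRGA): set $f_0:=0$ and $r_0:=f$. For each $m\ge 1$, given $f_{m-1}$ and $r_{m-1}$: (1) choose $g_m\in\mathcal D$ with $\langle r_{m-1},g_m\rangle=\sup_{g\in\mathcal D}\langle r_{m-1},g\rangle$ (such an element is assumed to exist); (2) set $f_m:=(1-\gamma_m)f_{m-1}+\gamma_m g_m$, where $\gamma_m\in[0,1]$ is a minimizer over $\gamma\in[0,1]$ of $\bigl\|f-\bigl((1-\gamma)f_{m-1}+\gamma g_m\bigr)\bigr\|^2$ (if $g_m=f_{m-1}$, every $\gamma\in[0,1]$ is a minimizer and one takes $\gamma_m=0$);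 (3) set $r_m:=f-f_m$. *)

(* Defs.v *)
From HB Require Import structures.
From mathcomp Require Import all_boot all_order all_algebra.
From mathcomp Require Import all_classical all_reals all_analysis.
Import Order.TTheory GRing.Theory Num.Theory.
Import numFieldNormedType.Exports.

Set Implicit Arguments.
Unset Strict Implicit.
Unset Printing Implicit Defensive.

Local Open Scope classical_set_scope.
Local Open Scope ring_scope.

(* A real Hilbert space is a complete normed module [H] over [R : realType]
   with a symmetric positive definite bilinear form [dot : {dot H for idfun}]
   such that [induces_norm dot]. *)
Definition induces_norm (R : realType) (H : completeNormedModType R)
    (dot : {dot H for idfun}) : Prop :=
  forall u : H, `|u| = Num.sqrt (dot u u).

Definition lin_span (R : realType) (H : completeNormedModType R)
    (D : set H) : set H :=
  [set f | exists (n : nat) (a : 'I_n -> R) (g : 'I_n -> H),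
     (forall k, D (g k)) /\ f = \sum_(k < n) a k *: g k].

Definition dictionary (R : realType) (H : completeNormedModType R)
    (D : set H) : Prop :=
  [/\ forall g, D g -> `|g| = 1,
      forall g, D g -> D (- g)
    & dense (lin_span D)].

Definition A1 (R : realType) (H : completeNormedModType R)
    (D : set H) : set H :=
  closure [set f | exists (n : nat) (a : 'I_n -> R) (g : 'I_n -> H),
     [/\ forall k, D (g k),
         f = \sum_(k < n) a k *: g k
       & \sum_(k < n) `|a k| <= 1]].

Definition relax (R : realType) (H : completeNormedModType R)
    (u g : H) (c : R) : H :=
  (1 - c) *: u + c *: g.

(* Neither the greedy choice of [g m] nor, a priori, [c m] is a function of the
   past, so the algorithm is a predicate on runs. The entries [g 0] and [c 0]
   are unused. *)
Definition CRGA_run (R : realType) (H : completeNormedModType R)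
    (dot : {dot H for idfun}) (D : set H) (f : H)
    (fm rm g : nat -> H) (c : nat -> R) : Prop :=
  [/\ fm 0%N = 0, rm 0%N = f
    & forall m : nat,
      [/\ D (g m.+1) /\
            dot (rm m) (g m.+1) = sup [set dot (rm m) h | h in D],
          c m.+1 \in `[0, 1] /\
            (forall t : R, t \in `[0, 1] ->
               `|f - relax (fm m) (g m.+1) (c m.+1)| ^+ 2
                 <= `|f - relax (fm m) (g m.+1) t| ^+ 2),
          g m.+1 = fm m -> c m.+1 = 0,
          fm m.+1 = relax (fm m) (g m.+1) (c m.+1)
        & rm m.+1 = f - fm m.+1]].

Definition CRGA_sequence (R : realType) (H : completeNormedModType R)
    (dot : {dot H for idfun}) (D : set H) (f : H) (fm : nat -> H) : Prop :=
  exists (rm g : nat -> H) (c : nat -> R), CRGA_run dot D f fm rm g c.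

(* Main.v *)
(* Since f lies in the closed symmetric convex hull of D, the greedy atom g
   satisfies <r, g> >= <r, f>, so <r, g - f_m> >= |r|^2 for r = f - f_m, while
   |g - f_m| <= 2. The optimal relaxation parameter does at least as well as
   |r|^2 / 4, so a_m = |f - f_m|^2 / 4 satisfies a_(m+1) <= a_m (1 - a_m); with
   a_0 <= 1/4 this gives a_m <= 1 / (m + 4). *)
Require Import Defs.
From HB Require Import structures.
From mathcomp Require Import all_boot all_order all_algebra.
From mathcomp Require Import all_classical all_reals all_analysis.
From mathcomp Require Import ring lra.
Import Order.TTheory GRing.Theory Num.Theory.
Import numFieldNormedType.Exports.
Local Open Scope classical_set_scope.
Local Open Scope ring_scope.

Section InnerProduct.
Context {R : realType} {H : completeNormedModType R} {dot : {dot H for idfun}}.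
Hypothesis dotN : induces_norm dot.

Lemma dot_sym (u v : H) : dot u v = dot v u.
Proof. by rewrite hermC /= expr0 mul1r. Qed.

Lemma dot_normsq (u : H) : dot u u = `|u| ^+ 2.
Proof.
have [->|u0] := eqVneq u 0; first by rewrite linear0l normr0 expr0n.
by rewrite dotN sqr_sqrtr// ltW// neq0_dnorm_gt0.
Qed.

Lemma normsq_subZ (u v : H) (t : R) :
  `|u - t *: v| ^+ 2 = `|u| ^+ 2 - 2 * t * dot u v + t ^+ 2 * `|v| ^+ 2.
Proof.
rewrite -!dot_normsq linearBl !linearBr.
rewrite !linearZl_LR !linearZr_LR /= (dot_sym v u) /GRing.scale /=; ring.
Qed.

Lemma dot_CauchySchwarz (u v : H) : `|dot u v| <= `|u| * `|v|.
Proof.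
have [->|v0] := eqVneq v 0; first by rewrite linear0r normr0 mulr_ge0.
have nv0 : 0 < `|v| by rewrite normr_gt0.
rewrite -(@ler_pXn2r _ 2) ?nnegrE ?mulr_ge0// real_normK ?num_real//.
(* The coefficient is that of the orthogonal projection of [u] on [v], so the square expands to the
   Cauchy-Schwarz defect. *)
have := sqr_ge0 `|u - (dot u v / `|v| ^+ 2) *: v|.
rewrite normsq_subZ.
have -> : `|u| ^+ 2 - 2 * (dot u v / `|v| ^+ 2) * dot u v +
    (dot u v / `|v| ^+ 2) ^+ 2 * `|v| ^+ 2 =
    `|u| ^+ 2 - dot u v ^+ 2 / `|v| ^+ 2.
  by field; rewrite gt_eqF.
by rewrite subr_ge0 ler_pdivrMr ?exprn_gt0// exprMn.
Qed.

End InnerProduct.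

(** Subadditivity and homogeneity give the bound on finite combinations with coefficient sum at most
    1, and the Lipschitz estimate carries it to the closure. It serves for the norm and for
    [|dot r h|] as a function of [h]. *)
Lemma A1_seminorm_le (R : realType) (H : completeNormedModType R) (D : set H)
    (p : H -> R) (L C : R) :
  (forall u v, p (u + v) <= p u + p v) ->
  (forall a u, p (a *: u) = `|a| * p u) ->
  (forall u, p u <= L * `|u|) ->
  0 <= C -> (forall g, D g -> p g <= C) ->
  forall f, A1 D f -> p f <= C.
Proof.
move=> pD pZ pL C0 pC f fA; apply/ler_addgt0Pr => e e0.
have L1 : 0 < `|L| + 1 by rewrite ltr_wpDl.
(* Within this radius [p (f - s)] is at most [e]; adding 1 keeps the denominator positive even if
   [L] is zero. *)
have d0 : 0 < e / (`|L| + 1) by rewrite divr_gt0.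
have [_ [[n [a [g [gD -> a1]]]]]] := fA _ (nbhsx_ballx f _ d0).
rewrite -ball_normE /= => fs.
set s := \sum_(k < n) _ in fs *.
have ps : p s <= C.
  have : p s <= \sum_(k < n) `|a k| * C.
    apply: (big_ind2 (fun u x => p u <= x)) => [|u x v y ux vy|k _].
    - by rewrite -(scale0r (0 : H)) pZ normr0 mul0r.
    - exact: le_trans (pD _ _) (lerD ux vy).
    - by rewrite pZ ler_wpM2l// pC.
  move=> /le_trans; apply.
  by rewrite -mulr_suml ler_piMl.
have : p (f - s) <= e.
  apply: le_trans (pL _) _; apply: (@le_trans _ _ ((`|L| + 1) * `|f - s|)).
    by rewrite ler_wpM2r//; have := ler_norm L; lra.
  by rewrite -ler_pdivlMl// mulrC ltW.
by have := pD s (f - s); rewrite addrC subrK; lra.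
Qed.

Lemma A1_norm_le1 (R : realType) (H : completeNormedModType R) (D : set H)
    (f : H) : dictionary D -> A1 D f -> `|f| <= 1.
Proof.
move=> [D1 _ _]; apply: (@A1_seminorm_le _ _ _ _ 1) => //.
- exact: ler_normD.
- exact: normrZ.
- by move=> u; rewrite mul1r.
- by move=> g /D1 ->.
Qed.

Lemma dot_A1_le_sup (R : realType) (H : completeNormedModType R)
    (dot : {dot H for idfun}) (D : set H) (r f : H) :
  induces_norm dot -> dictionary D -> D !=set0 -> A1 D f ->
  dot r f <= sup [set dot r h | h in D].
Proof.
move=> dotN [D1 DN _] [g0 g0D] fA; set S := sup _.
have leS h : D h -> dot r h <= S.
  move=> hD; apply: ub_le_sup; last by exists h.
  exists `|r| => _ [k kD <-].
  apply: le_trans (ler_norm _) _; apply: le_trans (dot_CauchySchwarz dotN _ _) _.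
  by rewrite (D1 _ kD) mulr1.
(* Symmetry of [D] turns the one-sided bound into a bound on a seminorm. *)
have leSn h : D h -> `|dot r h| <= S.
  by move=> hD; rewrite ler_norml leS// andbT lerNl -linearNr leS//; exact: DN.
apply: le_trans (ler_norm _) _.
apply: (@A1_seminorm_le _ _ D (fun h => `|dot r h|) `|r| S) => //.
- by move=> u v; rewrite linearDr ler_normD.
- by move=> a u; rewrite linearZr_LR /= normrM.
- by move=> u; exact: dot_CauchySchwarz.
- exact: le_trans (normr_ge0 _) (leSn _ g0D).
Qed.

(** With E the squared norm of [f - u], the new squared error at [t] is at most E - 2tE + 4t^2,
    because [dot (f - u) (g - u)] is at least E. *)
Lemma relaxed_step_le (R : realType) (H : completeNormedModType R)
    (dot : {dot H for idfun}) (f u g : H) :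
  induces_norm dot -> `|f - u| <= 2 -> `|g - u| <= 2 ->
  dot (f - u) f <= dot (f - u) g ->
  exists2 t : R, t \in `[0, 1] &
    `|f - relax u g t| ^+ 2 / 4 <=
      (`|f - u| ^+ 2 / 4) * (1 - `|f - u| ^+ 2 / 4).
Proof.
move=> dotN fu2 gu2 fg.
have E4 : `|f - u| ^+ 2 <= 4.
  by have := normr_ge0 (f - u); nra.
have G4 : `|g - u| ^+ 2 <= 4.
  by have := normr_ge0 (g - u); nra.
have fgu : `|f - u| ^+ 2 <= dot (f - u) (g - u).
  by rewrite -(dot_normsq dotN) !linearBr; lra.
have E0 := sqr_ge0 `|f - u|.
set E := `|f - u| ^+ 2 in E4 fgu E0 *.
(* This minimizes E - 2tE + 4t^2, with value E - E^2/4; it lies in the unit interval since E is at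
   most 4. *)
exists (E / 4); first by rewrite in_itv /=; lra.
have -> : f - relax u g (E / 4) = (f - u) - (E / 4) *: (g - u).
  by rewrite /relax scalerBl scale1r scalerBr !opprD !opprK !addrA addrAC.
rewrite (normsq_subZ dotN) -/E.
nra.
Qed.

(** The map y(1 - y) is increasing up to 1/2, and at y = 1/x its value (x - 1)/x^2 is at most 1/(x +
    1). The induction keeps [a m] below the threshold under which the recursion is assumed. *)
Lemma logistic_decay (R : realFieldType) (a : nat -> R) (k : nat) :
  (0 < k)%N -> a 0%N <= k.+1%:R^-1 ->
  (forall m, a m <= k.+1%:R^-1 -> a m.+1 <= a m * (1 - a m)) ->
  forall m, a m <= (m + k.+1)%:R^-1.
Proof.
move=> k0 a0 aS; elim=> [//|m IH].
have am : a m <= k.+1%:R^-1.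
  by apply: le_trans IH _; rewrite lef_pV2 ?posrE// ler_nat leq_addl.
apply: le_trans (aS _ am) _.
have -> : (m.+1 + k.+1 = (m + k.+1).+1)%N by [].
rewrite -natr1; set x : R := (m + k.+1)%:R in IH *.
(* Positivity of [k] puts 1/x in the range where the map is increasing. *)
have x2 : 2 <= x by rewrite ler_nat addnS ltnS (leq_trans k0)// leq_addl.
have x0 : 0 < x by lra.
have y0 : 0 < x^-1 by rewrite invr_gt0.
have y2 : x^-1 <= 2^-1 by rewrite lef_pV2 ?posrE.
apply: (@le_trans _ _ (x^-1 * (1 - x^-1))); first by nra.
rewrite -subr_ge0.
have -> : (x + 1)^-1 - x^-1 * (1 - x^-1) = (x ^+ 2 * (x + 1))^-1.
  by field; apply/andP; split; rewrite gt_eqF//; lra.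
by rewrite invr_ge0 mulr_ge0 ?sqr_ge0//; lra.
Qed.

Theorem theorem2p5 (R : realType) (H : completeNormedModType R)
    (dot : {dot H for idfun}) (dotN : induces_norm dot)
    (D : set H) (hD : dictionary D)
    (f : H) (hf : A1 D f)
    (fm : nat -> H) (hfm : CRGA_sequence dot D f fm) (m : nat) :
  `|f - fm m| <= 2 / Num.sqrt (m + 4)%:R.
Proof.
have [rm [g [c [f0 r0 step]]]] := hfm.
have f1 : `|f| <= 1 := A1_norm_le1 _ _ _ _ hD hf.
have gD n : D (g n.+1) by have [[]] := step n.
have g1 n : `|g n.+1| = 1 by have [D1 _ _] := hD; exact: D1.
have rmE n : rm n = f - fm n.
  by case: n => [|n]; [rewrite r0 f0 subr0|have [] := step n].
(* Convex combinations stay in the unit ball, whence the bounds by 2 that [relaxed_step_le]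
   requires. *)
have fm1 n : `|fm n| <= 1.
  elim: n => [|n IH]; first by rewrite f0 normr0.
  have [_ [+ _] _ -> _] := step n; rewrite in_itv /= => /andP[c0 c1].
  apply: le_trans (ler_normD _ _) _.
  rewrite !normrZ g1 (ger0_norm c0) ger0_norm ?subr_ge0//.
  by have := normr_ge0 (fm n); nra.
have decay n : `|f - fm n.+1| ^+ 2 / 4 <=
    (`|f - fm n| ^+ 2 / 4) * (1 - `|f - fm n| ^+ 2 / 4).
  have [[_ gsup] [_ cmin] _ fmS _] := step n.
  have [||| t t01 tle] := @relaxed_step_le _ _ dot f (fm n) (g n.+1) dotN.
  - by apply: le_trans (ler_normB _ _) _; have := fm1 n; lra.
  - by apply: le_trans (ler_normB _ _) _; have := fm1 n; rewrite g1; lra.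
  (* The chosen atom itself witnesses that [D] is nonempty. *)
  - by rewrite -rmE gsup; apply: dot_A1_le_sup => //; exists (g n.+1).
  - by apply: le_trans tle; rewrite fmS; have := cmin t t01; lra.
have : `|f - fm m| ^+ 2 / 4 <= (m + 4)%:R^-1.
  (* The value 3 matches the initial bound 1/4, which comes from [f1]. *)
  apply: (@logistic_decay _ (fun n => `|f - fm n| ^+ 2 / 4) 3) => //.
  by rewrite f0 subr0; have := normr_ge0 f; nra.
have s0 : 0 < Num.sqrt (m + 4)%:R :> R by rewrite sqrtr_gt0 ltr0n addn4.
rewrite ler_pdivrMr// => le4.
rewrite -(@ler_pXn2r _ 2) ?nnegrE ?divr_ge0 ?(ltW s0)//.
by rewrite expr_div_n sqr_sqrtr//; lra.
Qed.
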